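(* Let $S$ be a (not necessarily finite) semigroup. Then $S$ is a medial semigroup such that the index of $\theta_S$ is $2$ if and only if $S$ is isomorphic to a semigroup of Type 1, a semigroup of Type 2, a semigroup of Type 3, or a semigroup of Type 4 (these types being defined in the context).
   Context: A semigroup is a nonempty set with an associative multiplication. For a semigroup $S$, $\theta_S$ is the kernel of the right regular representation $a\mapsto \varrho_a$, $\varrho_a: x\mapsto xa$; that is, $(a,b)\in\theta_S$ if and only if $sa=sb$ for all $s\in S$. It is a congruence on $S$. The index of $\theta_S$ is the number $|S/\theta_S|$ of its classes. $S$ is medial if $axyb=ayxb$ for all $a,x,y,b\in S$. A left zero semigroup satisfies $ab=a$; a zero semigroup is a semigroup with a zero element $0$ satisfying $ab=0$. If $I$ is an ideal (nonempty, two-sided) of $S$, the Rees factor $S/I$ is obtained by collapsing $I$ to a single zero element. A retract homomorphism of $S$ onto an ideal $I$ is a homomorphism of $S$ onto $I$ leaving the elements of $I$ fixed; if one exists, $S$ is called a retract ideal extension of $I$ by $S/I$. If a semigroup $A$ is a retract ideal extension of a left zero semigroup $E_A$ by a zero semigroup (i.e. $A/E_A$ is a zero semigroup), and $\varphi_A$ is a retract homomorphism of $A$ onto $E_A$, then $E_A=A^2$ is the set of all idempotents of $A$ and $a_1a_2=\varphi_A(a_1)$ for all $a_1,a_2\in A$. The notation $E_B,\varphi_B$ is analogous for a semigroup $B$. All mappings act from the left: $(f\circ g)(x)=f(g(x))$. Type 1. Let $A$, $B$ be disjoint semigroups, each a retract ideal extension of a left zero semigroup ($E_A$, resp. $E_B$)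 by a zero semigroup, with retract homomorphisms $\varphi_A:A\to E_A$, $\varphi_B:B\to E_B$. Let $\alpha$ be a homomorphism of $A$ into $E_B$ and $\beta$ a homomorphism of $B$ into itself leaving the elements of $E_B$ fixed, such that $\alpha\circ\varphi_A=\alpha$, $\beta\circ\beta=\beta$, $\varphi_B\circ\beta=\varphi_B$. The semigroup is $A\cup B$ with the operation: $xy=\varphi_A(x)$ if $x,y\in A$; $xy=\alpha(x)$ if $x\in A,y\in B$; $xy=\beta(x)$ if $x\in B,y\in A$; $xy=\varphi_B(x)$ if $x,y\in B$. Type 2. Let $B$ be a semigroup which is a retract ideal extension of a left zero semigroup $E_B$ by a zero semigroup, with retract homomorphism $\varphi_B:B\to E_B$, and let $A$ be a nonempty set disjoint from $B$. Let $\alpha$ be a mapping of $A$ into $B$, $\beta$ a mapping of $A$ into $E_B$, and $\gamma$ a homomorphism of $B$ into itself leaving the elements of $E_B$ fixed. Assume that $\alpha\neq\beta$ or $\gamma\neq\varphi_B$, and that $\varphi_B\circ\alpha=\beta=\gamma\circ\alpha$ and $\varphi_B\circ\gamma=\varphi_B=\gamma\circ\gamma$. The semigroup is $A\cup B$ with the operation: $xy=\alpha(x)$ if $x,y\in A$; $xy=\beta(x)$ if $x\in A,y\in B$; $xy=\gamma(x)$ if $x\in B,y\in A$; $xy=\varphi_B(x)$ if $x,y\in B$. Type 3. Let $A$ be a semigroup which is a retract ideal extension of a left zero semigroup $E_A$ by a zero semigroup, with retract homomorphism $\varphi_A:A\to E_A$, and let $B$ be a nonempty set disjoint from $A$. Let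 $\alpha$ be a mapping of $A$ into $B$ and $\gamma$ a mapping of $B$ into $E_A$ such that $\alpha=\alpha\circ\varphi_A$ and $\gamma\circ\alpha=\varphi_A$. Put $\beta=\alpha\circ\gamma$. The semigroup is $A\cup B$ with the operation: $xy=\varphi_A(x)$ if $x,y\in A$; $xy=\alpha(x)$ if $x\in A,y\in B$; $xy=\beta(x)$ if $x\in B,y\in A$; $xy=\gamma(x)$ if $x,y\in B$. Type 4. Let $A$, $B$ be disjoint semigroups, each a retract ideal extension of a left zero semigroup ($E_A$, resp. $E_B$) by a zero semigroup, with retract homomorphisms $\varphi_A:A\to E_A$, $\varphi_B:B\to E_B$. Let $\alpha$ be a homomorphism of $A$ into $E_B$ and $\beta$ a homomorphism of $B$ into $E_A$ such that $\alpha\circ\varphi_A=\alpha=\varphi_B\circ\alpha$, $\beta\circ\varphi_B=\beta=\varphi_A\circ\beta$, $\alpha\circ\beta=\varphi_B$, $\beta\circ\alpha=\varphi_A$. The semigroup is $A\cup B$ with the operation: $xy=\varphi_A(x)$ if $x,y\in A$; $xy=\alpha(x)$ if $x\in A,y\in B$; $xy=\beta(x)$ if $x\in B,y\in A$; $xy=\varphi_B(x)$ if $x,y\in B$. *)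

(* Defs.v *)
From HB Require Import structures.
From mathcomp Require Import all_boot.
From mathcomp Require Import boolp classical_sets functions cardinality.

Set Implicit Arguments.
Unset Strict Implicit.
Unset Printing Implicit Defensive.

Local Open Scope classical_set_scope.
Local Open Scope group_scope.

(* [semigroupType] allows an empty carrier, so nonemptiness is always required
   separately, as [[set: S] !=set0]. Its choice structure is no restriction:
   classically, every type carries one ([gen_choiceMixin] in boolp). *)

Definition medial (S : semigroupType) : Prop :=
  forall a x y b : S, a * x * y * b = a * y * x * b.

Definition right_reg (S : semigroupType) (a : S) : S -> S := fun x => x * a.

Definition theta (S : semigroupType) (a b : S) : Prop :=
  right_reg a =1 right_reg b.

Definition theta_classes (S : semigroupType) : set (set S) :=
  range (fun a : S => [set b | theta a b]).

Arguments theta_classes : clear implicits.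

Definition isomorphic (S T : semigroupType) : Prop :=
  exists f : {multiplicative S -> T}, bijective f.

Record ideal (S : semigroupType) := Ideal {
  ideal_set :> set S;
  ideal_neq0 : ideal_set !=set0;
  ideal_mull : forall s x : S, ideal_set x -> ideal_set (s * x);
  ideal_mulr : forall s x : S, ideal_set x -> ideal_set (x * s)
}.

Section ReesFactor.
Variables (S : semigroupType) (I : ideal S).

(* The Rees factor S/I: [None] is the class I, and [Some x] is the class {x}
   for x outside I. The library's [insub] is then the canonical projection. *)
Definition rees : Type := option (~` (I : set S)).

Definition rees_proj (x : S) : rees := insub x.

Definition rees_mul (u v : rees) : rees :=
  match u, v with
  | Some x, Some y => rees_proj (val x * val y)
  | _, _ => None
  end.

Lemma rees_projN (x : S) : ideal_set I x -> rees_proj x = None.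
Proof.
move=> Ix; rewrite /rees_proj insubF //; apply/negbTE/negP => /set_mem; exact.
Qed.

Lemma rees_projM (x y : S) :
  rees_mul (rees_proj x) (rees_proj y) = rees_proj (x * y).
Proof.
have [Ix|nIx] := pselect (ideal_set I x).
  by rewrite (rees_projN Ix) (rees_projN (ideal_mulr _ Ix)).
have [Iy|nIy] := pselect (ideal_set I y).
  rewrite (rees_projN Iy) (rees_projN (ideal_mull _ Iy)).
  by case: (rees_proj x).
have mx : x \in ~` (I : set S) by apply/mem_set.
have my : y \in ~` (I : set S) by apply/mem_set.
by rewrite {1 2}/rees_proj !insubT.
Qed.

Lemma rees_proj_val (x : ~` (I : set S)) : rees_proj (val x) = Some x.
Proof. exact: valK. Qed.

Lemma rees_mulA : associative rees_mul.
Proof.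
move=> [x|] [y|] [z|] //=; last by case: rees_proj.
have := rees_projM (val x) (val y * val z).
have := rees_projM (val x * val y) (val z).
by rewrite !rees_proj_val mulgA => e1 e2; apply: (etrans e2 (esym e1)).
Qed.

HB.instance Definition _ := Choice.on rees.
HB.instance Definition _ := isSemigroup.Build rees rees_mulA.
End ReesFactor.

Definition zero_semigroup (S : semigroupType) : Prop :=
  exists z : S,
    (forall a : S, z * a = z /\ a * z = z) /\ (forall a b : S, a * b = z).

Definition left_zero_on (S : semigroupType) (E : set S) : Prop :=
  forall a b : S, E a -> E b -> a * b = a.

Definition retract_hom (S : semigroupType) (I : ideal S)
    (f : {multiplicative S -> S}) : Prop :=
  range f = I /\ (forall x : S, ideal_set I x -> f x = x).

(* A retract ideal extension of the left zero semigroup [core_ideal] by a zero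
   semigroup, together with a retract homomorphism [phi] onto it. *)
Record lz_ext := LzExt {
  lz_sort :> semigroupType;
  lz_neq0 : [set: lz_sort] !=set0;
  core_ideal : ideal lz_sort;
  core_left_zero : left_zero_on core_ideal;
  core_rees_zero : zero_semigroup (rees core_ideal);
  phi : {multiplicative lz_sort -> lz_sort};
  phi_retract : retract_hom core_ideal phi
}.

Arguments core_ideal : clear implicits.
Arguments phi : clear implicits.

Definition core (A : lz_ext) : set A := core_ideal A.

Arguments core : clear implicits.

Section LzExtTheory.
Variable A : lz_ext.

Lemma phi_core (x : A) : core A (phi A x).
Proof. by rewrite /core; case: (phi_retract A) => <- _; exists x. Qed.

Lemma phi_id (x : A) : core A x -> phi A x = x.
Proof. by case: (phi_retract A) => _; apply. Qed.

Lemma phi_idem (x : A) : phi A (phi A x) = phi A x.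
Proof. exact/phi_id/phi_core. Qed.
End LzExtTheory.

(* In each construction the disjoint union of A and B is the sum type. *)

Record type1 := Type1 {
  A1 : lz_ext;
  B1 : lz_ext;
  alpha1 : {multiplicative A1 -> B1};
  beta1 : {multiplicative B1 -> B1};
  alpha1_core : range alpha1 `<=` core B1;
  beta1_id : forall x : B1, core B1 x -> beta1 x = x;
  alpha1_phi : alpha1 \o phi A1 =1 alpha1;
  beta1_beta : beta1 \o beta1 =1 beta1;
  phi_beta1 : phi B1 \o beta1 =1 phi B1
}.

Section Type1.
Variable D : type1.

Definition type1_sort : Type := (A1 D + B1 D)%type.

Definition type1_mul (x y : type1_sort) : type1_sort :=
  match x, y with
  | inl a, inl _ => inl (phi (A1 D) a)
  | inl a, inr _ => inr (alpha1 D a)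
  | inr b, inl _ => inr (beta1 D b)
  | inr b, inr _ => inr (phi (B1 D) b)
  end.

Lemma type1_mulA : associative type1_mul.
Proof.
have aE x : core (B1 D) (alpha1 D x) by apply: (@alpha1_core D); exists x.
have h1 := @alpha1_phi D; have h2 := @beta1_beta D; have h3 := @phi_beta1 D.
move=> [x|x] [y|y] [z|z] /=; congr (_ _);
  by rewrite ?phi_idem ?[phi _ (alpha1 _ _)]phi_id //
    ?(beta1_id (aE _)) ?(beta1_id (phi_core _))
    ?[alpha1 _ (phi _ _)]h1 ?[beta1 _ (beta1 _ _)]h2
    ?[phi _ (beta1 _ _)]h3.
Qed.

HB.instance Definition _ := Choice.on type1_sort.
HB.instance Definition _ := isSemigroup.Build type1_sort type1_mulA.
End Type1.

Record type2 := Type2 {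
  A2 : choiceType;
  A2_neq0 : [set: A2] !=set0;
  B2 : lz_ext;
  alpha2 : A2 -> B2;
  beta2 : A2 -> B2;
  gamma2 : {multiplicative B2 -> B2};
  beta2_core : range beta2 `<=` core B2;
  gamma2_id : forall x : B2, core B2 x -> gamma2 x = x;
  type2_neq : ~ (alpha2 =1 beta2) \/ ~ (gamma2 =1 phi B2);
  phi_alpha2 : phi B2 \o alpha2 =1 beta2;
  gamma2_alpha2 : beta2 =1 gamma2 \o alpha2;
  phi_gamma2 : phi B2 \o gamma2 =1 phi B2;
  gamma2_gamma2 : phi B2 =1 gamma2 \o gamma2
}.

Section Type2.
Variable D : type2.

Definition type2_sort : Type := (A2 D + B2 D)%type.

Definition type2_mul (x y : type2_sort) : type2_sort :=
  match x, y with
  | inl a, inl _ => inr (alpha2 a)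
  | inl a, inr _ => inr (beta2 a)
  | inr b, inl _ => inr (gamma2 D b)
  | inr b, inr _ => inr (phi (B2 D) b)
  end.

Lemma type2_mulA : associative type2_mul.
Proof.
have bE x : core (B2 D) (beta2 x) by apply: (@beta2_core D); exists x.
have h1 := @phi_alpha2 D; have h2 := @gamma2_alpha2 D.
have h3 := @phi_gamma2 D; have h4 := @gamma2_gamma2 D.
move=> [x|x] [y|y] [z|z] /=; congr (_ _);
  by rewrite ?phi_idem ?[phi _ (beta2 _)]phi_id //
    ?(gamma2_id (bE _)) ?(gamma2_id (phi_core _))
    ?[phi _ (alpha2 _)]h1 -?[gamma2 _ (alpha2 _)]h2
    ?[phi _ (gamma2 _ _)]h3 -?[gamma2 _ (gamma2 _ _)]h4.
Qed.

HB.instance Definition _ := Choice.on type2_sort.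
HB.instance Definition _ := isSemigroup.Build type2_sort type2_mulA.
End Type2.

Record type3 := Type3 {
  A3 : lz_ext;
  B3 : choiceType;
  B3_neq0 : [set: B3] !=set0;
  alpha3 : A3 -> B3;
  gamma3 : B3 -> A3;
  gamma3_core : range gamma3 `<=` core A3;
  alpha3_phi : alpha3 =1 alpha3 \o phi A3;
  gamma3_alpha3 : gamma3 \o alpha3 =1 phi A3
}.

Section Type3.
Variable D : type3.

Definition beta3 : B3 D -> B3 D := @alpha3 D \o @gamma3 D.

Definition type3_sort : Type := (A3 D + B3 D)%type.

Definition type3_mul (x y : type3_sort) : type3_sort :=
  match x, y with
  | inl a, inl _ => inl (phi (A3 D) a)
  | inl a, inr _ => inr (alpha3 a)
  | inr b, inl _ => inr (beta3 b)
  | inr b, inr _ => inl (gamma3 b)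
  end.

Lemma type3_mulA : associative type3_mul.
Proof.
have gE x : core (A3 D) (gamma3 x) by apply: (@gamma3_core D); exists x.
have h1 := @alpha3_phi D; have h2 := @gamma3_alpha3 D.
have h1' x : alpha3 (phi (A3 D) x) = alpha3 x by rewrite [RHS]h1.
have h2' x : gamma3 (alpha3 x) = phi (A3 D) x by exact: h2.
move=> [x|x] [y|y] [z|z] /=; congr (_ _);
  by rewrite /beta3 /= ?h2' ?phi_idem ?h1' ?(phi_id (gE _)).
Qed.

HB.instance Definition _ := Choice.on type3_sort.
HB.instance Definition _ := isSemigroup.Build type3_sort type3_mulA.
End Type3.

Record type4 := Type4 {
  A4 : lz_ext;
  B4 : lz_ext;
  alpha4 : {multiplicative A4 -> B4};
  beta4 : {multiplicative B4 -> A4};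
  alpha4_core : range alpha4 `<=` core B4;
  beta4_core : range beta4 `<=` core A4;
  alpha4_phi : alpha4 \o phi A4 =1 alpha4;
  phi_alpha4 : alpha4 =1 phi B4 \o alpha4;
  beta4_phi : beta4 \o phi B4 =1 beta4;
  phi_beta4 : beta4 =1 phi A4 \o beta4;
  alpha4_beta4 : alpha4 \o beta4 =1 phi B4;
  beta4_alpha4 : beta4 \o alpha4 =1 phi A4
}.

Section Type4.
Variable D : type4.

Definition type4_sort : Type := (A4 D + B4 D)%type.

Definition type4_mul (x y : type4_sort) : type4_sort :=
  match x, y with
  | inl a, inl _ => inl (phi (A4 D) a)
  | inl a, inr _ => inr (alpha4 D a)
  | inr b, inl _ => inl (beta4 D b)
  | inr b, inr _ => inr (phi (B4 D) b)
  end.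

Lemma type4_mulA : associative type4_mul.
Proof.
have h1 := @alpha4_phi D; have h2 := @phi_alpha4 D.
have h3 := @beta4_phi D; have h4 := @phi_beta4 D.
have h5 := @alpha4_beta4 D; have h6 := @beta4_alpha4 D.
move=> [x|x] [y|y] [z|z] /=; congr (_ _);
  by rewrite ?phi_idem ?[alpha4 _ (phi _ _)]h1 -?[phi _ (alpha4 _ _)]h2
    ?[beta4 _ (phi _ _)]h3 -?[phi _ (beta4 _ _)]h4
    ?[alpha4 _ (beta4 _ _)]h5 ?[beta4 _ (alpha4 _ _)]h6.
Qed.

HB.instance Definition _ := Choice.on type4_sort.
HB.instance Definition _ := isSemigroup.Build type4_sort type4_mulA.
End Type4.

(* Main.v *)
(* The product xy depends on y only through its theta-class, so S is governed by
   its two right multiplications and by the two-element semigroup T = S / theta.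
   Theta-classes being separated by right multiplications, S is medial iff
   xyb = yxb holds in T; this excludes the left zero semigroup and leaves the
   semilattice, the zero semigroup, the group of order 2 and the right zero
   semigroup, which give Types 1, 2, 3 and 4 respectively. In each type A and B
   are the two theta-classes, and all the maps are restrictions of the two right
   multiplications. *)

Require Import Defs.
From HB Require Import structures.
From mathcomp Require Import all_boot.
From mathcomp Require Import boolp classical_sets functions cardinality.

Local Open Scope group_scope.
Local Open Scope classical_set_scope.

(** * Index two as a Boolean-valued quotient map *)

Definition separates_theta {S : semigroupType} (c : S -> bool) : Prop :=
  [/\ forall a b, theta a b <-> c a = c b, exists a, c a & exists b, ~~ c b].

Lemma theta_mul {S : semigroupType} {c : S -> bool} :
  (forall a b, theta a b <-> c a = c b) ->
  forall x y z : S, c y = c z -> x * y = x * z.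
Proof. by move=> cP x y z /cP/(_ x). Qed.

Lemma index2P (S : semigroupType) :
  (theta_classes S #= `I_2)%card <-> exists c : S -> bool, separates_theta c.
Proof.
have classP (a b : S) : [set x | theta a x] = [set x | theta b x] <-> theta a b.
  split=> [ab|ab]; first by have : [set x | theta a x] b by rewrite ab.
  by apply/seteqP; split=> x /= xx y; rewrite -[RHS]xx ?ab.
split=> [/card_set_bijP[f [fhomo finj fsurj]]|[c [cP [a0 ca0] [b0 cb0]]]].
  have cl a : theta_classes S [set x | theta a x] by exists a.
  exists (fun a => f [set x | theta a x] == 0%N); split=> [a b||].
  - split=> [/classP -> //|e]; apply/classP/finj; [exact/mem_set|exact/mem_set|].
    by have := fhomo _ (cl a); have := fhomo _ (cl b); move: e => /=;
      case: (f _) => [|[]] //; case: (f _) => [|[]].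
  - by have [//|_ [a _ <-] fa] := fsurj 0%N; exists a; rewrite fa.
  - by have [//|_ [a _ <-] fa] := fsurj 1%N; exists a; rewrite fa.
(* [c] is constant on each class, so one member where [c] holds decides the value 0 or 1 of the
   class. *)
pose f (C : set S) : nat := `[< exists2 x, C x & c x >].
have fE a : f [set x | theta a x] = c a.
  congr nat_of_bool; apply/asboolP/idP => [[x /cP -> //]|ca].
  by exists a => //; apply/cP.
apply/card_set_bijP; exists f; split.
- by move=> _ [a _ <-]; rewrite fE /=; case: (c a).
- move=> _ _ /set_mem[a _ <-] /set_mem[b _ <-]; rewrite !fE => e.
  by apply/classP/cP; move: e; case: (c a); case: (c b).
- move=> [|[|//]] _.
    by exists [set x | theta b0 x]; [exists b0|rewrite fE (negbTE cb0)].
  by exists [set x | theta a0 x]; [exists a0|rewrite fE ca0].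
Qed.

Lemma medial_isomorphic {S T : semigroupType} :
  isomorphic S T -> medial T -> medial S.
Proof.
move=> [f /bij_inj finj] medT a x y b; apply: finj.
by rewrite !gmulfM; apply: medT.
Qed.

Lemma separates_theta_isomorphic {S T : semigroupType} {c : T -> bool} :
  isomorphic S T -> separates_theta c -> exists d : S -> bool, separates_theta d.
Proof.
move=> [f [g gK fK]] [cP [a ca] [b cb]]; exists (c \o f); split=> [u v||].
- rewrite -cP; split=> uv x.
    by rewrite -[x]fK /right_reg -!gmulfM; congr (f _); apply: uv.
  by apply: (can_inj gK); rewrite !gmulfM; apply: uv.
- by exists (g a); rewrite /= fK.
- by exists (g b); rewrite /= fK.
Qed.

(* Right multiplications by theta-equivalent elements agree, so axyb = ayxb as
   soon as xyb and yxb are theta-equivalent. *)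
Lemma medial_separates_theta {S : semigroupType} {c : S -> bool} :
  separates_theta c -> (forall x y b : S, c (x * y * b) = c (y * x * b)) ->
  medial S.
Proof.
by move=> [cP _ _] cC a x y b; rewrite -!(mulgA a) (theta_mul cP _ _ _ (cC _ _ _)).
Qed.

(** * The four types have index two *)

Definition is_inl {A B : Type} (u : A + B) : bool :=
  if u is inl _ then true else false.

(** Multiplying [inl a] on the right by elements of different summands lands in different summands;
    the same test works for Types 3 and 4. *)
Lemma type1_separates (D : type1) :
  separates_theta (@is_inl _ _ : type1_sort D -> bool).
Proof.
have [a _] := lz_neq0 (A1 D); have [b _] := lz_neq0 (B1 D).
split; [|by exists (inl a)|by exists (inr b)].
by move=> [x|x] [y|y]; split=> // /(_ (inl a)).
Qed.

(** All products lie in [B2], so the summand of a product tells nothing. Instead, an equivalence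
    across the summands would force both [alpha2 =1 beta2] and [gamma2 =1 phi (B2 D)], against
    [type2_neq]. *)
Lemma type2_separates (D : type2) :
  separates_theta (@is_inl _ _ : type2_sort D -> bool).
Proof.
have [a _] := A2_neq0 D; have [b _] := lz_neq0 (B2 D).
have ab x y : ~ theta (inl x : type2_sort D) (inr y).
  move=> e; case: (type2_neq D); apply=> z.
    by case: (e (inl z)).
  by case: (e (inr z)).
split; [|by exists (inl a)|by exists (inr b)].
by move=> [x|x] [y|y]; split=> //; [move/ab|move/fsym/ab].
Qed.

Lemma type3_separates (D : type3) :
  separates_theta (@is_inl _ _ : type3_sort D -> bool).
Proof.
have [a _] := lz_neq0 (A3 D); have [b _] := B3_neq0 D.
split; [|by exists (inl a)|by exists (inr b)].
by move=> [x|x] [y|y]; split=> // /(_ (inl a)).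
Qed.

Lemma type4_separates (D : type4) :
  separates_theta (@is_inl _ _ : type4_sort D -> bool).
Proof.
have [a _] := lz_neq0 (A4 D); have [b _] := lz_neq0 (B4 D).
split; [|by exists (inl a)|by exists (inr b)].
by move=> [x|x] [y|y]; split=> // /(_ (inl a)).
Qed.

(** * Retract ideal extensions built from idempotent maps *)

Definition pack_multiplicative {G H : magmaType} {f : G -> H}
  (fM : {morph f : x y / x * y}) : {multiplicative G -> H} :=
  HB.pack f (isMultiplicative.Build G H f fM).

(* The multiplication xy = p x determined by an idempotent self-map p. *)
Definition idem_sg {X : choiceType} {p : X -> X}
  (pp : forall x, p (p x) = p x) : Type := X.

Section IdemSemigroup.
Variables (X : choiceType) (p : X -> X) (pp : forall x, p (p x) = p x).

Definition idem_mul (x y : idem_sg pp) : idem_sg pp := p x.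

Lemma idem_mulA : associative idem_mul.
Proof. by move=> x y z; rewrite /idem_mul pp. Qed.

HB.instance Definition _ := Choice.on (idem_sg pp).
HB.instance Definition _ := isSemigroup.Build (idem_sg pp) idem_mulA.

Variable x0 : X.

Definition idem_ideal : ideal (idem_sg pp).
Proof.
refine (@Ideal (idem_sg pp) (range p) _ _ _).
- by exists (p x0); exists x0.
- by move=> s x _; exists s.
- by move=> s x _; exists x.
Defined.

Lemma idem_phiM : {morph (p : idem_sg pp -> idem_sg pp) : x y / x * y}.
Proof. by []. Qed.

Lemma idem_left_zero : left_zero_on idem_ideal.
Proof. by move=> _ b [a _ <-] _; apply: pp. Qed.

Lemma idem_rees_zero : zero_semigroup (rees idem_ideal).
Proof.
exists None; split=> [[]//|[a|] [b|] //].
by apply: rees_projN; exists (val a).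
Qed.

Lemma idem_retract : retract_hom idem_ideal (pack_multiplicative idem_phiM).
Proof. by split=> // _ [x _ <-]; apply: pp. Qed.

(** In a retract ideal extension of this kind every product is the retraction of its left factor, so
    an idempotent map carries all the data; [x0] supplies nonemptiness. *)
Definition idem_lz_ext : lz_ext :=
  @LzExt (idem_sg pp) (ex_intro _ x0 I) idem_ideal idem_left_zero
    idem_rees_zero (pack_multiplicative idem_phiM) idem_retract.

End IdemSemigroup.

Lemma bijective_isomorphic (S T : semigroupType) (h : T -> S) :
  bijective h -> {morph h : x y / x * y} -> isomorphic S T.
Proof.
move=> [f hK fK] hM; have fM : {morph f : x y / x * y}.
  by move=> x y; apply: (can_inj hK); rewrite hM !fK.
by exists (pack_multiplicative fM), h.
Qed.

(** * Recovering each type from the two classes *)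

Section Decomposition.
Variables (S : semigroupType) (c : S -> bool).
Hypothesis cP : forall a b, theta a b <-> c a = c b.
Variables a0 b0 : S.
Hypotheses (ca0 : c a0) (cb0 : ~~ c b0).

Definition rmul {P Q : pred S} {e : S} (h : forall x, P x -> Q (x * e))
  (u : {x | P x}) : {x | Q x} := exist _ (val u * e) (h _ (valP u)).

(* Naming this predicate keeps the unification of [Q] in [rmul] first-order. *)
Let N : pred S := fun x => ~~ c x.
Let A : choiceType := {x | c x}.
Let B : choiceType := {x | N x}.

Definition glue (u : A + B) : S :=
  match u with inl x => val x | inr x => val x end.

Lemma glue_bijective : bijective glue.
Proof.
have glueS x : {u | glue u = x}.
  by have [cx|cx] := boolP (c x);
    [exists (inl (exist _ x cx))|exists (inr (exist _ x cx))].
exists (fun x => sval (glueS x)) => [u|x]; last by case: (glueS x).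
case: (glueS _) => /= v; case: u v => [[x cx]|[x cx]] [[y cy]|[y cy]] /= e;
  subst y; by first [rewrite (bool_irrelevance cx cy)
    | exfalso; move: cx cy; rewrite /N; case: (c _)].
Qed.

(** Both sides reassociate to one element times words in [a0] and [b0]; these words act alike as
    soon as [cM] gives them the same class. *)
Ltac rmul_eq cM :=
  move=> *; apply: val_inj => /=; rewrite -?mulgA; apply: (theta_mul cP);
  rewrite ?cM ?ca0 ?(negbTE cb0).

Lemma type1_of : (forall x y, c (x * y) = c x && c y) ->
  exists D : type1, isomorphic S (type1_sort D).
Proof.
move=> cM.
have hA x : c x -> c (x * a0) by rewrite cM ca0 => ->.
have hB x : N x -> N (x * b0) by rewrite /N cM => /negbTE->.
have hAB x : c x -> N (x * b0) by rewrite /N cM (negbTE cb0) andbF.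
have hBA x : N x -> N (x * a0) by rewrite /N cM => /negbTE->.
have ppA u : rmul hA (rmul hA u) = rmul hA u by rmul_eq cM.
have ppB u : rmul hB (rmul hB u) = rmul hB u by rmul_eq cM.
pose XA := idem_lz_ext _ _ ppA (exist _ a0 ca0).
pose XB := idem_lz_ext _ _ ppB (exist _ b0 cb0).
have alphaM : {morph (rmul hAB : XA -> XB) : x y / x * y} by rmul_eq cM.
have betaM : {morph (rmul hBA : XB -> XB) : x y / x * y} by rmul_eq cM.
unshelve epose (D := @Type1 XA XB (pack_multiplicative alphaM)
  (pack_multiplicative betaM) _ _ _ _ _).
(* The core of [XB] is the range of right multiplication by [b0], and that multiplication fixes
   [x * b0]. *)
- by move=> _ [u _ <-]; exists (rmul hAB u) => //; rmul_eq cM.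
- by move=> _ [u _ <-]; rmul_eq cM.
- by rmul_eq cM.
- by rmul_eq cM.
- by rmul_eq cM.
exists D; apply: (bijective_isomorphic S (type1_sort D) glue glue_bijective)
  => -[[x cx]|[x cx]] [[y cy]|[y cy]] /=;
  by apply: (theta_mul cP); rewrite ?ca0 ?(negbTE cb0) ?cy ?(negbTE cy).
Qed.

Lemma type2_of : (forall x y, c (x * y) = false) ->
  exists D : type2, isomorphic S (type2_sort D).
Proof.
move=> cM.
have hB x : N x -> N (x * b0) by rewrite /N cM.
have hAA x : c x -> N (x * a0) by rewrite /N cM.
have hAB x : c x -> N (x * b0) by rewrite /N cM.
have hBA x : N x -> N (x * a0) by rewrite /N cM.
have ppB u : rmul hB (rmul hB u) = rmul hB u by rmul_eq cM.
pose XB := idem_lz_ext _ _ ppB (exist _ b0 cb0).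
have gammaM : {morph (rmul hBA : XB -> XB) : x y / x * y} by rmul_eq cM.
have A_neq0 : [set: A] !=set0 by exists (exist _ a0 ca0).
unshelve epose (D := @Type2 A A_neq0 XB (rmul hAA) (rmul hAB)
  (pack_multiplicative gammaM) _ _ _ _ _ _ _).
- by move=> _ [u _ <-]; exists (rmul hAB u) => //; rmul_eq cM.
- by move=> _ [u _ <-]; rmul_eq cM.
(* If both equalities held, [a0] and [b0] would have the same right multiplication on both
   classes. *)
- apply/not_andP => -[ab gp].
  have /cP : theta a0 b0 by move=> x; have [cx|cx] := boolP (c x);
    [have := ab (exist _ x cx)|have := gp (exist _ x cx)] => /(congr1 val).
  by rewrite ca0 (negbTE cb0).
- by rmul_eq cM.
- by rmul_eq cM.
- by rmul_eq cM.
- by rmul_eq cM.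
exists D; apply: (bijective_isomorphic S (type2_sort D) glue glue_bijective)
  => -[[x cx]|[x cx]] [[y cy]|[y cy]] /=;
  by apply: (theta_mul cP); rewrite ?ca0 ?(negbTE cb0) ?cy ?(negbTE cy).
Qed.

Lemma type3_of : (forall x y, c (x * y) = (c x == c y)) ->
  exists D : type3, isomorphic S (type3_sort D).
Proof.
move=> cM.
have hA x : c x -> c (x * a0) by rewrite cM ca0 => ->.
have hAB x : c x -> N (x * b0) by rewrite /N cM (negbTE cb0) => ->.
have hBB x : N x -> c (x * b0) by rewrite /N cM (negbTE cb0) => /negbTE->.
have ppA u : rmul hA (rmul hA u) = rmul hA u by rmul_eq cM.
pose XA := idem_lz_ext _ _ ppA (exist _ a0 ca0).
have B_neq0 : [set: B] !=set0 by exists (exist _ b0 cb0).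
unshelve epose (D := @Type3 XA B B_neq0 (rmul hAB) (rmul hBB) _ _ _).
- by move=> _ [u _ <-]; exists (rmul hBB u) => //; rmul_eq cM.
- by rmul_eq cM.
- by rmul_eq cM.
exists D; apply: (bijective_isomorphic S (type3_sort D) glue glue_bijective)
  => -[[x cx]|[x cx]] [[y cy]|[y cy]] /=;
  (* The map [beta3] multiplies by [b0] twice, and [b0 * b0] lies in the class of [a0]. *)
  by rewrite -?mulgA; apply: (theta_mul cP);
    rewrite ?cM ?ca0 ?(negbTE cb0) ?cy ?(negbTE cy).
Qed.

Lemma type4_of : (forall x y, c (x * y) = c y) ->
  exists D : type4, isomorphic S (type4_sort D).
Proof.
move=> cM.
have hA x : c x -> c (x * a0) by rewrite cM.
have hB x : N x -> N (x * b0) by rewrite /N cM.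
have hAB x : c x -> N (x * b0) by rewrite /N cM.
have hBA x : N x -> c (x * a0) by rewrite /N cM.
have ppA u : rmul hA (rmul hA u) = rmul hA u by rmul_eq cM.
have ppB u : rmul hB (rmul hB u) = rmul hB u by rmul_eq cM.
pose XA := idem_lz_ext _ _ ppA (exist _ a0 ca0).
pose XB := idem_lz_ext _ _ ppB (exist _ b0 cb0).
have alphaM : {morph (rmul hAB : XA -> XB) : x y / x * y} by rmul_eq cM.
have betaM : {morph (rmul hBA : XB -> XA) : x y / x * y} by rmul_eq cM.
unshelve epose (D := @Type4 XA XB (pack_multiplicative alphaM)
  (pack_multiplicative betaM) _ _ _ _ _ _ _ _).
- by move=> _ [u _ <-]; exists (rmul hAB u) => //; rmul_eq cM.
- by move=> _ [u _ <-]; exists (rmul hBA u) => //; rmul_eq cM.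
- by rmul_eq cM.
- by rmul_eq cM.
- by rmul_eq cM.
- by rmul_eq cM.
- by rmul_eq cM.
- by rmul_eq cM.
exists D; apply: (bijective_isomorphic S (type4_sort D) glue glue_bijective)
  => -[[x cx]|[x cx]] [[y cy]|[y cy]] /=;
  by apply: (theta_mul cP); rewrite ?ca0 ?(negbTE cb0) ?cy ?(negbTE cy).
Qed.

End Decomposition.

(* The associative operations m on bool with m (m x y) z = m (m y x) z; they
   fall into four orbits under exchanging true and false. *)
Lemma bool_medial_cases (m : bool -> bool -> bool) :
  associative m -> (forall x y z, m (m x y) z = m (m y x) z) ->
  [\/ m =2 andb \/ m =2 orb,
      m =2 (fun _ _ => false) \/ m =2 (fun _ _ => true),
      m =2 eq_op \/ m =2 addb
    | m =2 (fun _ y => y)].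
Proof.
move=> mA mC.
(* Of the sixteen tables, seven survive. Left projection is associative and falls only to [mC]; the
   other eight violate [mA]. *)
case tt : (m true true); case tf : (m true false);
  case ft : (m false true); case ff : (m false false);
  first [ by constructor 1; left; do 2!case
        | by constructor 1; right; do 2!case
        | by constructor 2; left; do 2!case
        | by constructor 2; right; do 2!case
        | by constructor 3; left; do 2!case
        | by constructor 3; right; do 2!case
        | by constructor 4; do 2!case
        | exfalso;
          move: (mA true true true) (mA true true false) (mA true false true)
            (mA true false false) (mA false true true) (mA false true false)
            (mA false false true) (mA false false false)
            (mC true false true) (mC true false false);
          by rewrite !(tt, tf, ft, ff) ].
Qed.

Theorem theorem3p5 (S : semigroupType) (S_neq0 : [set: S] !=set0) :
  (medial S /\ (theta_classes S #= `I_2)%card) <->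
  [\/ exists D : type1, isomorphic S (type1_sort D),
      exists D : type2, isomorphic S (type2_sort D),
      exists D : type3, isomorphic S (type3_sort D)
    | exists D : type4, isomorphic S (type4_sort D)].
Proof.
split=> [[medS /index2P[c [cP [a0 ca0] [b0 cb0]]]]|].
  (* Passing to [~~ c] exchanges the classes and reduces the second operation of each pair to the
     first. *)
  have ncP a b : theta a b <-> ~~ c a = ~~ c b.
    by rewrite cP; split=> [->|/negb_inj].
  have nca0 : ~~ ~~ c a0 by rewrite negbK.
  pose r (i : bool) := if i then a0 else b0.
  have cr i : c (r i) = i by case: i => //; apply/negbTE.
  (* The multiplication of S/theta, transported to [bool] through the representatives [r]. *)
  pose m i j := c (r i * r j).
  have cM x y : c (x * y) = m (c x) (c y).
    apply/cP => z; rewrite /right_reg !mulgA.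
    (* In [z * x * y], first [y] and then [x] is replaced by its representative. *)
    rewrite (theta_mul cP _ y (r (c y))) ?cr //; congr (_ * _).
    by apply: (theta_mul cP); rewrite cr.
  have mA : associative m.
    by move=> i j k; rewrite -(cr i) -(cr j) -(cr k) -!cM mulgA.
  have mC i j k : m (m i j) k = m (m j i) k.
    rewrite -(cr i) -(cr j) -(cr k) -!cM.
    by apply/cP => z; rewrite /right_reg !mulgA; apply: medS.
  have [[mE|mE]|[mE|mE]|[mE|mE]|mE] := bool_medial_cases m mA mC.
  - by constructor 1; apply: (type1_of _ c cP _ _ ca0 cb0) => x y; rewrite cM mE.
  - constructor 1; apply: (type1_of _ (fun x => ~~ c x) ncP _ _ cb0 nca0) => x y.
    by rewrite cM mE negb_or.
  - by constructor 2; apply: (type2_of _ c cP _ _ ca0 cb0) => x y; rewrite cM mE.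
  - by constructor 2; apply: (type2_of _ (fun x => ~~ c x) ncP _ _ cb0 nca0) => x y; rewrite cM mE.
  - by constructor 3; apply: (type3_of _ c cP _ _ ca0 cb0) => x y; rewrite cM mE.
  - constructor 3; apply: (type3_of _ (fun x => ~~ c x) ncP _ _ cb0 nca0) => x y.
    by rewrite cM mE; case: (c x) (c y) => -[].
  - by constructor 4; apply: (type4_of _ c cP _ _ ca0 cb0) => x y; rewrite cM mE.
(* In every model the summand of a product depends only on the summands of its factors, so mediality
   reduces to a finite check. *)
move=> H; have [T [c [iso csep cC]]] : exists (T : semigroupType) (c : T -> bool),
    [/\ isomorphic S T, separates_theta c &
        forall x y b : T, c (x * y * b) = c (y * x * b)].
  case: H => -[D iso].
  - exists (type1_sort D), is_inl; split=> //; first exact: type1_separates.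
    by move=> [?|?] [?|?] [?|?].
  - exists (type2_sort D), is_inl; split=> //; first exact: type2_separates.
    by move=> [?|?] [?|?] [?|?].
  - exists (type3_sort D), is_inl; split=> //; first exact: type3_separates.
    by move=> [?|?] [?|?] [?|?].
  - exists (type4_sort D), is_inl; split=> //; first exact: type4_separates.
    by move=> [?|?] [?|?] [?|?].
split; last exact/index2P/(separates_theta_isomorphic iso csep).
exact: medial_isomorphic iso (medial_separates_theta csep cC).
Qed.
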